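(* Let $m,n,s,k$ be four integers such that $3\leq s\leq n$, $3\leq k\leq m$ and $ms=nk$. If $s\equiv 0\pmod 4$ and $k\neq 5$ is odd, then there exists an integer Heffter array $\mathrm{H}(m,n;s,k)$.
   Context: A partially filled (pf) array is a matrix some of whose cells may be empty; row and column sums are taken over the filled cells. An integer Heffter array $\mathrm{H}(m,n;s,k)$ is an $m\times n$ pf array with entries in $\{\pm1,\pm2,\ldots,\pm nk\}\subset\mathbb{Z}$ such that: (a) each row contains exactly $s$ filled cells and each column contains exactly $k$ filled cells; (b) no two entries agree in absolute value; (c) the elements in every row and in every column sum to $0$ in $\mathbb{Z}$. *)

(* Defs.v *)
From HB Require Import structures.
From mathcomp Require Import all_boot all_order all_algebra.

Set Implicit Arguments.
Unset Strict Implicit.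
Unset Printing Implicit Defensive.

Import Order.TTheory GRing.Theory Num.Theory.

Local Open Scope ring_scope.

(* [None] is an empty cell. *)
Definition pf_array (T : Type) (m n : nat) : Type := 'M[option T]_(m, n).

Section PfArray.

Variables (m n : nat) (A : pf_array int m n).

Definition filled (i : 'I_m) (j : 'I_n) : bool := isSome (A i j).

Definition row_filled (i : 'I_m) : nat := #|[set j | filled i j]|.

Definition col_filled (j : 'I_n) : nat := #|[set i | filled i j]|.

(* The default 0 of [odflt] is never used, as the sums skip empty cells. *)
Definition row_sum (i : 'I_m) : int := \sum_(j | filled i j) odflt 0 (A i j).

Definition col_sum (j : 'I_n) : int := \sum_(i | filled i j) odflt 0 (A i j).

End PfArray.

Record integer_heffter (m n s k : nat) (A : pf_array int m n) : Prop := {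
  heffter_entries : forall i j x, A i j = Some x -> (1 <= `|x| <= n * k)%N;
  heffter_row_filled : forall i, row_filled A i = s;
  heffter_col_filled : forall j, col_filled A j = k;
  heffter_abs_inj : forall i j i' j' x y,
    A i j = Some x -> A i' j' = Some y -> `|x|%N = `|y|%N ->
    (i, j) = (i', j');
  heffter_row_sum : forall i, row_sum A i = 0;
  heffter_col_sum : forall j, col_sum A j = 0
}.

(* Main.v *)
(* Put s = 4t; since k is odd, n = 4u and mt = ku. Suppose given u blocks of
   size k x 4, all with zero row and column sums, whose entries have exactly the
   absolute values 1, ..., 4ku. Block b occupies the columns 4b, ..., 4b + 3, and
   its row r is dealt to row kb + r mod m of the array: as k <= m, the rows of one
   block go to distinct rows, and every row of the array receives t block rows.

   The blocks are stacked from explicit 3 x 4 arrays, available for every u, and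
   from 4 x 4 and 6 x 4 arrays with as many positive as negative entries in each
   line; adding a constant to the absolute values of the latter keeps the line
   sums, so they can be placed on any interval of integers. This yields every odd
   k >= 3 except 5. *)
Require Import Defs.
From mathcomp Require Import all_boot all_order all_algebra zify.

Set Implicit Arguments.
Unset Strict Implicit.
Unset Printing Implicit Defensive.

Import Order.TTheory GRing.Theory Num.Theory.

Local Open Scope ring_scope.

(* Entry [E b r c] sits in row [r] and column [c] of the block [b]. *)
Record block_system (u k : nat) (E : nat -> nat -> nat -> int) : Prop := {
  block_bound : forall b r c, (b < u)%N -> (r < k)%N -> (c < 4)%N ->
    (1 <= `|E b r c| <= u * k * 4)%N;
  block_inj : forall b r c b' r' c',
    (b < u)%N -> (r < k)%N -> (c < 4)%N ->
    (b' < u)%N -> (r' < k)%N -> (c' < 4)%N ->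
    `|E b r c|%N = `|E b' r' c'|%N -> [/\ b = b', r = r' & c = c'];
  block_row : forall b r, (b < u)%N -> (r < k)%N -> \sum_(c < 4) E b r c = 0;
  block_col : forall b c, (b < u)%N -> (c < 4)%N -> \sum_(r < k) E b r c = 0
}.

Lemma big_ord_muln (T : Type) (idx : T) (op : Monoid.law idx) (a d : nat)
    (P : pred nat) (F : nat -> T) :
  \big[op/idx]_(j < a * d | P j) F j =
  \big[op/idx]_(b < a) \big[op/idx]_(c < d | P (b * d + c)%N) F (b * d + c)%N.
Proof.
elim: a => [|a IHa]; first by rewrite mul0n !big_ord0.
rewrite big_ord_recr -IHa mulSnr -(big_mkord P F).
rewrite (big_cat_nat (n := (a * d)%N)) ?leq_addr //= big_mkord; congr (op _ _).
rewrite -{1}(add0n (a * d)%N) big_addn addKn big_mkord.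
by apply: eq_big => i; rewrite addnC.
Qed.

Lemma modn_addn_inj (m a : nat) (i i' : 'I_m) :
  (i + a = i' + a %[mod m])%N -> i = i'.
Proof.
move/eqP; rewrite eqn_modDr !modn_small // => /eqP; exact: val_inj.
Qed.

(** * Dealing the rows of the blocks to the rows of the array *)

Section Deal.

Variables (m u k t : nat) (E : nat -> nat -> nat -> int).
Hypotheses (k_le_m : (k <= m)%N) (mt_uk : (m * t = u * k)%N).
Hypothesis E_sys : block_system u k E.

(* The [r] in [0 .. m - 1] such that row [r] of block [b] would be dealt to
   row [i]; it is an actual block row only if [r < k]. *)
Definition slot (i b : nat) : nat := ((i + (m - (b * k) %% m)) %% m)%N.

Definition deal : pf_array int m (u * 4) :=
  \matrix_(i, j) if (slot i (j %/ 4) < k)%N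
                 then Some (E (j %/ 4) (slot i (j %/ 4)) (j %% 4)) else None.

(** Adding [m - (b * k) %% m] subtracts [b * k] modulo [m], and [r < k <= m] makes [r] its own
    residue. *)
Lemma slotP (i b r : nat) : (i < m)%N -> (r < k)%N ->
  ((b * k + r) %% m == i)%N = (r == slot i b).
Proof.
move=> im rk; have rm := leq_trans rk k_le_m.
have m0 : (0 < m)%N by apply: leq_trans im.
rewrite /slot -{1}(modn_small im) -{2}(modn_small rm).
rewrite -(eqn_modDr (m - (b * k) %% m)); congr (_ == _).
rewrite [(_ + r)%N]addnC -addnA -modnDmr -modnDml modnDml.
by rewrite -[((b * k + _) %% m)%N]modnDml subnKC ?modnn ?addn0 // ltnW ?ltn_pmod.
Qed.

(** For fixed [b], [slot] is a rotation of the residues modulo [m], so the rows of the array that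
    block [b] meets correspond one to one to its [k] rows. *)
Lemma big_slot (T : Type) (idx : T) (op : Monoid.com_law idx) (b : nat)
    (F : nat -> T) :
  \big[op/idx]_(i < m | (slot i b < k)%N) F (slot i b) =
  \big[op/idx]_(r < k) F r.
Proof.
rewrite (big_ord_widen m) //.
pose h (i : 'I_m) : 'I_m :=
  Ordinal (ltn_pmod (i + (m - (b * k) %% m)) (leq_ltn_trans (leq0n i) (ltn_ord i))).
by rewrite [RHS](reindex_inj (h := h)) // => i i' /(congr1 val) /modn_addn_inj.
Qed.

Lemma filled_deal (i : 'I_m) (j : 'I_(u * 4)) :
  filled deal i j = (slot i (j %/ 4) < k)%N.
Proof. by rewrite /filled mxE; case: ifP. Qed.

Lemma deal_entry (i : 'I_m) (j : 'I_(u * 4)) :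
  odflt 0 (deal i j) =
  if (slot i (j %/ 4) < k)%N then E (j %/ 4) (slot i (j %/ 4)) (j %% 4) else 0.
Proof. by rewrite mxE; case: ifP. Qed.

Lemma card_slots (i : nat) : (i < m)%N -> (\sum_(b < u) (slot i b < k) = t)%N.
Proof.
move=> im; transitivity (\sum_(b < u) \sum_(r < k | (b * k + r) %% m == i) 1)%N.
  apply: eq_bigr => b _; under eq_bigl => r do rewrite slotP //.
  case: ltnP => [ik|ki]; last by rewrite big_pred0 // => r; rewrite ltn_eqF // (leq_trans _ ki).
  by rewrite (big_pred1 (Ordinal ik)).
(* The numbers [b * k + r] run through all [q < u * k = t * m]. Cut into [t] runs of length [m]
   instead, they meet the residue [i] once per run. *)
rewrite -(big_ord_muln _ _ _ (fun q => q %% m == i)%N (fun=> 1%N)) -mt_uk mulnC.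
rewrite (big_ord_muln _ _ _ (fun q => q %% m == i)%N (fun=> 1%N)).
rewrite -[RHS](card_ord t) -sum1_card; apply: eq_bigr => l _.
rewrite (big_pred1 (Ordinal im)) // => a.
by rewrite modnMDl modn_small.
Qed.

Lemma divn4_lt (j : 'I_(u * 4)) : (j %/ 4 < u)%N.
Proof. by rewrite ltn_divLR. Qed.

Lemma deal_heffter : integer_heffter (t * 4) k deal.
Proof.
have someE i j x : deal i j = Some x ->
    (slot i (j %/ 4) < k)%N /\ x = E (j %/ 4) (slot i (j %/ 4)) (j %% 4).
  by rewrite mxE; case: ifP => // ? [].
split.
- move=> i j x /someE [rk ->]; rewrite mulnAC.
  by apply: block_bound => //; [exact: divn4_lt|exact: ltn_pmod].
- move=> i; rewrite /row_filled -sum1_card.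
  under eq_bigl => j do rewrite inE filled_deal.
  rewrite (big_ord_muln _ _ _ (fun j => slot i (j %/ 4) < k)%N (fun=> 1%N)).
  rewrite -(card_slots (ltn_ord i)) big_distrl; apply: eq_bigr => b _.
  under eq_bigl => c do rewrite divnMDl // divn_small // addn0.
  by rewrite big_mkcond !big_ord_recr big_ord0 /=; case: ltnP.
- move=> j; rewrite /col_filled -sum1_card.
  under eq_bigl => i do rewrite inE filled_deal.
  by rewrite (big_slot _ _ (fun=> 1%N)) sum1_card card_ord.
- move=> i j i' j' x y /someE [rk ->] /someE [rk' ->].
  case/(block_inj E_sys); rewrite ?divn4_lt ?ltn_pmod // => eb er ec.
  (* The columns come first: once they agree, both slots refer to the same block, and its rotation
     can be cancelled. *)
  have ej : j = j' by apply: val_inj; rewrite /= (divn_eq j 4) eb ec -divn_eq.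
  by subst j'; rewrite (modn_addn_inj er).
- move=> i; rewrite /row_sum; under eq_bigl => j do rewrite filled_deal.
  under eq_bigr => j do rewrite deal_entry.
  rewrite (big_ord_muln _ _ _ (fun j => slot i (j %/ 4) < k)%N
    (fun j => if (slot i (j %/ 4) < k)%N then E (j %/ 4) (slot i (j %/ 4)) (j %% 4) else 0)).
  apply: big1 => b _; case: (ltnP (slot i b) k) => [rk|kr]; last first.
    by rewrite big_pred0 // => c; rewrite divnMDl // divn_small // addn0 ltnNge kr.
  rewrite -[RHS](block_row E_sys (ltn_ord b) rk); apply: eq_big => c.
    by rewrite divnMDl // divn_small // addn0.
  by rewrite divnMDl // divn_small // addn0 rk modnMDl modn_small.
- move=> j; rewrite /col_sum; under eq_bigl => i do rewrite filled_deal.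
  rewrite -[RHS](block_col E_sys (divn4_lt j) (ltn_pmod j (isT : (0 < 4)%N))).
  rewrite -(big_slot _ (j %/ 4) (fun r => E (j %/ 4) r (j %% 4))).
  by apply: eq_bigr => i rk; rewrite deal_entry rk.
Qed.

End Deal.

(** * Explicit blocks of height 3 *)

Definition table_entry (T : seq (seq int)) (r c : nat) : int := (nth [::] T r)`_c.

(* [v + 2] arrays of size 3 x 4 whose absolute values partition [1 .. 12(v + 2)].
   For [i < v] the entries of array [i + 2] run through 12 arithmetic
   progressions of length [v]: the first row fills [1 .. 2v] and
   [2v + 5 .. 4v + 4] in steps of 2, and the eight others are intervals. Arrays
   0 and 1 use up the 24 numbers left in the gaps; the offsets were found by a
   computer search. *)
Definition heffter34_table (v : int) (b : nat) : seq (seq int) :=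
  match b with
  | 0 =>
    [:: [:: 2 * v + 1; - (2 * v + 3); - (4 * v + 5); 4 * v + 7];
        [:: 5 * v + 12; - (5 * v + 11); - (8 * v + 17); 8 * v + 16];
        [:: - (7 * v + 13); 7 * v + 14; 12 * v + 22; - (12 * v + 23)]]
  | 1 =>
    [:: [:: 2 * v + 2; - (2 * v + 4); - (4 * v + 6); 4 * v + 8];
        [:: 9 * v + 19; - (10 * v + 20); - (4 * v + 9); 5 * v + 10];
        [:: - (11 * v + 21); 12 * v + 24; 8 * v + 15; - (9 * v + 18)]]
  | b.+2 => let i := b%:Z in
    [:: [:: 2 * i + 1; - (2 * i + 2); 2 * v + 6 + 2 * i; - (2 * v + 5 + 2 * i)];
        [:: 6 * v + 12 - i; - (10 * v + 19 - i); - (7 * v + 15 + i); 11 * v + 22 + i];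
        [:: - (6 * v + 13 + i); 10 * v + 21 + i; 5 * v + 9 - i; - (9 * v + 17 - i)]]
  end.


(** All entries are affine in [v] and in the block index, so fixing the cell and one of the cases 0,
    1, at least 2 for the block leaves only linear arithmetic. *)
Lemma heffter34_blocks (v : nat) :
  block_system v.+2 3 (fun b => table_entry (heffter34_table v b)).
Proof.
split.
- move=> [|[|b]] [|[|[|//]]] [|[|[|[|//]]]] hb _ _; rewrite /table_entry /=; lia.
- move=> b r c b' r' c' hb hr hc hb' hr' hc'.
  case: b hb => [|[|b]] hb; case: b' hb' => [|[|b']] hb';
  case: r hr => [|[|[|//]]] _; case: r' hr' => [|[|[|//]]] _;
  case: c hc => [|[|[|[|//]]]] _; case: c' hc' => [|[|[|[|//]]]] _;
  rewrite /table_entry /= => e; split=> //; lia.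
- move=> [|[|b]] [|[|[|//]]] hb _; rewrite !big_ord_recr big_ord0 /table_entry /=; lia.
- move=> [|[|b]] [|[|[|[|//]]]] hb _; rewrite !big_ord_recr big_ord0 /table_entry /=; lia.
Qed.

(** A single block is treated apart, as the family above always contains its arrays 0 and 1. *)
Lemma heffter34_block :
  block_system 1 3 (fun=> table_entry
    [:: [:: 12; -11; -8; 7]; [:: -2; 6; -1; -3]; [:: -10; 5; 9; -4]]).
Proof.
split.
- by move=> b [|[|[|//]]] [|[|[|[|//]]]].
- move=> [|//] r c [|//] r' c' _ hr hc _ hr' hc'.
  case: r hr => [|[|[|//]]] _; case: r' hr' => [|[|[|//]]] _;
  by case: c hc => [|[|[|[|//]]]] _; case: c' hc' => [|[|[|[|//]]]] _.
- by move=> b [|[|[|//]]] _ _; rewrite !big_ord_recr big_ord0.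
- by move=> b [|[|[|[|//]]]] _ _; rewrite !big_ord_recr big_ord0.
Qed.

(** * Increasing the height of the blocks by shifted arrays *)

Record shiftable (h : nat) (S : nat -> nat -> int) : Prop := {
  shiftable_bound : forall r c, (r < h)%N -> (c < 4)%N ->
    (1 <= `|S r c| <= h * 4)%N;
  shiftable_inj : forall r c r' c',
    (r < h)%N -> (c < 4)%N -> (r' < h)%N -> (c' < 4)%N ->
    `|S r c|%N = `|S r' c'|%N -> r = r' /\ c = c';
  shiftable_row : forall r, (r < h)%N -> \sum_(c < 4) S r c = 0;
  shiftable_row_sg : forall r, (r < h)%N -> \sum_(c < 4) sgz (S r c) = 0;
  shiftable_col : forall c, (c < 4)%N -> \sum_(r < h) S r c = 0;
  shiftable_col_sg : forall c, (c < 4)%N -> \sum_(r < h) sgz (S r c) = 0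
}.

Definition shift (N : nat) (x : int) : int := x + sgz x * N%:Z.

Lemma absz_shift (N : nat) (x : int) : (0 < `|x|)%N ->
  `|shift N x|%N = (`|x| + N)%N.
Proof. by rewrite /shift; case: sgzP; lia. Qed.

(** The sum of the signs is the coefficient of [N]; hence the balance of signs is recorded in
    [shiftable] as a zero sum of [sgz]. *)
Lemma sum_shift (F : nat -> int) (a N : nat) :
  \sum_(i < a) F i = 0 -> \sum_(i < a) sgz (F i) = 0 ->
  \sum_(i < a) shift N (F i) = 0.
Proof. by move=> F0 sF0; rewrite big_split -big_distrl /= F0 sF0 mul0r. Qed.

(** The absolute values up to [u * k * 4] belong to [E]; above them, each block gets its own
    interval of length [h * 4]. *)
Definition stack (u k h : nat) (E : nat -> nat -> nat -> int)
    (S : nat -> nat -> int) (b r c : nat) : int :=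
  if (r < k)%N then E b r c
  else shift (u * k * 4 + b * (h * 4)) (S (r - k)%N c).

Lemma block_system_stack (u k h : nat) E S :
  block_system u k E -> shiftable h S ->
  block_system u (k + h) (stack u k h E S).
Proof.
move=> HE HS.
have top b r c : (b < u)%N -> (c < 4)%N -> (r < k)%N ->
    (1 <= `|stack u k h E S b r c| <= u * k * 4)%N.
  by move=> bu c4 rk; rewrite /stack rk; apply: block_bound.
have bot b r c : (r < h)%N -> (c < 4)%N ->
    (`|stack u k h E S b (k + r) c| = u * k * 4 + b * (h * 4) + `|S r c|)%N.
  move=> rh c4; rewrite /stack ltnNge leq_addr addKn absz_shift 1?addnC //.
  by case/andP: (shiftable_bound HS rh c4).
have rowP r : (r < k + h)%N -> (r < k)%N \/ exists2 r', (r' < h)%N & r = (k + r')%N.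
  case: (ltnP r k) => [|kr] rkh; [by left|right].
  by exists (r - k)%N; rewrite ?subnKC // ltn_subLR.
split.
- move=> b r c bu /rowP[rk|[r' rh ->]] c4.
    by have := top b r c bu c4 rk; nia.
  by rewrite bot //; have := shiftable_bound HS rh c4; nia.
- move=> b r c b' r' c' bu /rowP[rk|[q qh ->]] c4 bu' /rowP[rk'|[q' qh' ->]] c4'.
  + by rewrite /stack rk rk'; apply: (block_inj HE).
  + rewrite [in X in _ = X -> _]bot // => e.
    by have := top b r c bu c4 rk; have := shiftable_bound HS qh' c4'; lia.
  + rewrite bot // => e.
    by have := top b' r' c' bu' c4' rk'; have := shiftable_bound HS qh c4; lia.
  + rewrite !bot // => e.
    have Sb := shiftable_bound HS qh c4; have Sb' := shiftable_bound HS qh' c4'.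
    (* Both values of [S] lie between 1 and [h * 4], so distinct blocks would give disjoint
       intervals. *)
    have eb : b = b' by nia.
    have [|-> ->] // := shiftable_inj HS qh c4 qh' c4'.
    by rewrite eb in e; lia.
- move=> b r bu /rowP[rk|[q qh ->]]; rewrite /stack.
    by rewrite rk; apply: (block_row HE).
  rewrite ltnNge leq_addr addKn.
  by apply: (@sum_shift (S q)); [apply: shiftable_row HS _ _|apply: shiftable_row_sg HS _ _].
- move=> b c bu c4; rewrite big_split_ord /= /stack.
  under eq_bigr => r _ do rewrite ltn_ord.
  rewrite (block_col HE) // add0r.
  under eq_bigr => r _ do rewrite ltnNge leq_addr addKn.
  by apply: (@sum_shift (S^~ c)); [apply: shiftable_col HS _ _|apply: shiftable_col_sg HS _ _].
Qed.

Lemma shiftable4 : shiftable 4 (table_entry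
  [:: [:: 1; -2; -3; 4]; [:: -5; 6; 7; -8];
      [:: -9; 10; 11; -12]; [:: 13; -14; -15; 16]]).
Proof.
split.
- by move=> [|[|[|[|//]]]] [|[|[|[|//]]]].
- move=> r c r' c' hr hc hr' hc'.
  case: r hr => [|[|[|[|//]]]] _; case: r' hr' => [|[|[|[|//]]]] _;
  by case: c hc => [|[|[|[|//]]]] _; case: c' hc' => [|[|[|[|//]]]] _.
all: by move=> [|[|[|[|//]]]] _; rewrite !big_ord_recr big_ord0.
Qed.

(** Serves the [k] congruent to 1 modulo 4, from 9 on. Height 2 is impossible, since a column with
    entries x and -x repeats an absolute value; this is why 5 is not reached. *)
Lemma shiftable6 : shiftable 6 (table_entry
  [:: [:: 1; 4; -2; -3]; [:: -5; -8; 6; 7];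
      [:: 9; 16; -10; -15]; [:: -11; -14; 12; 13];
      [:: 23; 22; -24; -21]; [:: -17; -20; 18; 19]]).
Proof.
split.
- by move=> [|[|[|[|[|[|//]]]]]] [|[|[|[|//]]]].
- move=> r c r' c' hr hc hr' hc'.
  case: r hr => [|[|[|[|[|[|//]]]]]] _; case: r' hr' => [|[|[|[|[|[|//]]]]]] _;
  by case: c hc => [|[|[|[|//]]]] _; case: c' hc' => [|[|[|[|//]]]] _.
1,2: by move=> [|[|[|[|[|[|//]]]]]] _; rewrite !big_ord_recr big_ord0.
all: by move=> [|[|[|[|//]]]] _; rewrite !big_ord_recr big_ord0.
Qed.

(* [k - 3] is even and different from 2, hence of the form [4 a] or [6 + 4 a]. *)
Lemma block_system_exists (u k : nat) :
  (0 < u)%N -> (3 <= k)%N -> odd k -> k <> 5%N ->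
  exists E, block_system u k E.
Proof.
move=> u0.
have [E3 HE3] : exists E, block_system u 3 E.
  case: u u0 => [|[|v]] // _; eexists.
    exact: heffter34_block.
  exact: heffter34_blocks.
have add4 a k0 E0 : block_system u k0 E0 -> exists E, block_system u (k0 + a * 4) E.
  move=> HE0; elim: a => [|a [E HE]]; first by exists E0; rewrite addn0.
  by eexists; rewrite mulSnr addnA; apply: block_system_stack HE shiftable4.
move=> k3 kodd k5.
have [ek|ek] : (k = 3 + (k - 3) %/ 4 * 4 \/ k = (3 + 6) + (k - 9) %/ 4 * 4)%N by lia.
  by rewrite ek; apply: add4 HE3.
by rewrite ek; apply: add4 (block_system_stack HE3 shiftable6).
Qed.

Local Close Scope ring_scope.

Theorem theorem1p5 (m n s k : nat)
  (hs : 3 <= s <= n) (hk : 3 <= k <= m) (hmsnk : m * s = n * k)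
  (hs4 : s = 0 %[mod 4]) (hk5 : k <> 5) (hkodd : odd k) :
  exists A : pf_array int m n, integer_heffter s k A.
Proof.
have /dvdnP[t es] : 4 %| s by rewrite /dvdn hs4.
have /dvdnP[u en] : 4 %| n.
  (* The odd [k] is coprime to 4, and 4 divides [n * k = m * s]. *)
  rewrite -(@Gauss_dvdl 4 n k); last by rewrite (@coprime_pexpl 2 2) // coprime2n.
  by rewrite -hmsnk es mulnA dvdn_mull.
subst s n; case/andP: hk => k3 km.
have u0 : 0 < u by case: (u) hs => // /andP[]; lia.
have [E HE] := block_system_exists u0 k3 hkodd hk5.
have mt_uk : m * t = u * k by nia.
by exists (deal m u k E); apply: deal_heffter km mt_uk HE.
Qed.
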